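(* Let $N\ge2$ be even, $1\le M<N$, $\gcd(M,N)=1$, $L\ge3$, and let $\eta\in\mathbb Z_{2N}$ satisfy $\nu_\eta=+1$, where $\nu_\eta=(-1)^{\eta-(1-M)}$ (equivalently $\eta\equiv M-1\pmod 2$). Let $\kappa_\eta\in\{0,\dots,N-1\}$ be determined by $M\kappa_\eta\equiv-\eta\pmod N$ and put $c_\eta^+=2L+1-\kappa_\eta$, $c_\eta^-=-1-\kappa_\eta$. Then $c_\eta^+$ and $c_\eta^-$ are both odd, so for each branch $\sigma\in\{+,-\}$ the involution $m\mapsto c_\eta^\sigma-m\pmod N$ of the charge sectors $Q=\omega^m$, $m\in\mathbb Z_N$, has no fixed sector. Every simultaneous eigenstate of $Q$ and $H_\eta^\sigma(M;0)$ has a linearly independent partner eigenstate of $H_\eta^\sigma(M;0)$ with the same energy in a different $Q$-sector (namely, if the state lies in sector $m$, in the sector $c_\eta^\sigma-m$).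
   Context: Parameters: $\varepsilon=e^{i\pi/N}$, $q=\varepsilon^M$, $\omega=q^2$, $f_\eta=\varepsilon^\eta$. Endpoint space $\mathbb C^N_a$ with basis $|1\rangle,\dots,|N\rangle$ (indices mod $N$): $Z|n\rangle=\omega^n|n\rangle$, $X|n\rangle=|n+1\rangle$; $Y_{m,n}=X^mZ^n$. A physical site is $\mathbb C^2$ with basis $|0\rangle,|1\rangle$; $\sigma^+=|0\rangle\langle1|$, $\sigma^-=|1\rangle\langle0|$, $\sigma^z=\operatorname{diag}(1,-1)$. Bond density: $h_{j,j+1}=q\sigma_j^+\sigma_{j+1}^-+q^{-1}\sigma_j^-\sigma_{j+1}^++\frac{q+q^{-1}}4\sigma_j^z\sigma_{j+1}^z$. In the two-spin basis $|0\rangle=|00\rangle,|1\rangle=|01\rangle,|2\rangle=|10\rangle,|3\rangle=|11\rangle$ with $E_{rc}=|r\rangle\langle c|$ (tensor signs omitted), operators on $\mathbb C^2_A\otimes\mathbb C^2_B\otimes\mathbb C^N_a$: $$\begin{aligned}S_+=\tfrac12\bigl[&-E_{01}Y_{-1,-1}+q^3E_{02}Y_{-1,0}-q^4E_{03}Y_{-2,-1}-q^2E_{10}Y_{1,1}+q^2E_{12}Y_{0,1}-qE_{13}Y_{-1,0}\\&+q^{-3}E_{20}Y_{1,0}+q^{-2}E_{21}Y_{0,-1}+q^2E_{23}Y_{-1,-1}-E_{30}Y_{2,1}-q^{-1}E_{31}Y_{1,0}+E_{32}Y_{1,1}\bigr],\\ S_-=\tfrac12\bigl[&E_{01}Y_{-1,1}-qE_{02}Y_{-1,0}-E_{03}Y_{-2,1}+q^{-2}E_{10}Y_{1,-1}+q^2E_{12}Y_{0,-1}+q^3E_{13}Y_{-1,0}\\&-q^{-1}E_{20}Y_{1,0}+q^{-2}E_{21}Y_{0,1}-q^{-2}E_{23}Y_{-1,1}-q^{-4}E_{30}Y_{2,-1}+q^{-3}E_{31}Y_{1,0}-E_{32}Y_{1,-1}\bigr].\end{aligned}$$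 Output-normalized seam: $F_+^{(\eta)}=\operatorname{diag}(1,f_\eta)$, $F_-^{(\eta)}=\operatorname{diag}(f_\eta,1)$, $S^{(\eta)}_{\sigma,ABa}=F^{(\eta)}_{\sigma,B}S_{\sigma,ABa}F^{(\eta)\dagger}_{\sigma,B}$ ($F$ on the second physical site $B$). Ring: sites $0,\dots,L-1$ labelled by $\mathbb Z_L$, Hilbert space $(\mathbb C^2)^{\otimes L}\otimes\mathbb C^N_a$, $H_\eta^\sigma(M;k)=\sum_{j\ne k-1}h_{j,j+1}+S^{(\eta)}_{\sigma,k-1,k,a}$; the reference seam position is $k=0$ (seam on $(L-1,0)$). Charge: $Q=g^{\otimes L}\otimes Z_a^{-1}$, $g=\operatorname{diag}(1,\omega)$; $Q$ commutes with $H^\sigma_\eta(M;k)$. *)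

(* Defs.v *)
From mathcomp Require Import all_boot all_order all_algebra.
From mathcomp Require Import all_classical all_reals all_analysis.
From mathcomp Require Import complex mxtens.

Set Implicit Arguments.
Unset Strict Implicit.
Unset Printing Implicit Defensive.

Import Order.TTheory GRing.Theory Num.Theory.

Local Open Scope ring_scope.

(* The scalars are the complex numbers R[i], with R : realType.  The rings
   Z_N, Z_L and Z_2N are rendered by 'Z_N, 'Z_L and 'Z_(2 * N), whose carrier is
   the set of the least nonnegative residues as soon as the modulus is at least
   2.  The endpoint basis vector |n> is indexed by the residue of n, so |N> is
   the vector of index 0. *)

Variant branch := Plus | Minus.

Section Model.

Variables (R : realType) (N M : nat).

Local Notation C := R[i].
Local Notation dimE := (Zp_trunc N).+2.

Definition eps : C :=
  (cos (pi / N%:R : R) +i* sin (pi / N%:R : R))%C.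

Definition q : C := eps ^+ M.

Definition omega : C := q ^+ 2.

Definition phase (eta : 'Z_(2 * N)) : C := eps ^+ eta.

Definition clockZ : 'M[C]_dimE := diag_mx (\row_n omega ^+ n).

Definition shiftX : 'M[C]_dimE := \matrix_(m, n) (m == n + 1 :> 'Z_N)%:R.

Definition Yop (m n : int) : 'M[C]_dimE := shiftX ^ m * clockZ ^ n.

Definition diag2 (a b : C) : 'M[C]_2 :=
  diag_mx (\row_(i < 2) if i == 0 then a else b).

Definition sigmap : 'M[C]_2 := delta_mx 0 1.
Definition sigmam : 'M[C]_2 := delta_mx 1 0.
Definition sigmaz : 'M[C]_2 := diag2 1 (- 1).

(* In a Kronecker product A *t B the left index is the most significant one, so
   |ab> has index 2 * a + b in the two-spin basis. *)
Definition bond : 'M[C]_(2 * 2) :=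
  q *: (sigmap *t sigmam) + q^-1 *: (sigmam *t sigmap)
  + ((q + q^-1) / 4%:R) *: (sigmaz *t sigmaz).

Definition EY (r c : nat) (m n : int) : 'M[C]_(2 * 2 * dimE) :=
  (delta_mx (inord r : 'I_4) (inord c : 'I_4) : 'M[C]_(2 * 2)) *t Yop m n.

Local Notation E := EY.

Definition Sop (s : branch) : 'M[C]_(2 * 2 * dimE) :=
  match s with
  | Plus => 2%:R^-1 *:
     (- E 0 1 (-1) (-1)
      + q ^+ 3 *: E 0 2 (-1) 0
      - q ^+ 4 *: E 0 3 (-2) (-1)
      - q ^+ 2 *: E 1 0 1 1
      + q ^+ 2 *: E 1 2 0 1
      - q *: E 1 3 (-1) 0
      + q ^- 3 *: E 2 0 1 0
      + q ^- 2 *: E 2 1 0 (-1)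
      + q ^+ 2 *: E 2 3 (-1) (-1)
      - E 3 0 2 1
      - q^-1 *: E 3 1 1 0
      + E 3 2 1 1)
  | Minus => 2%:R^-1 *:
     (E 0 1 (-1) 1
      - q *: E 0 2 (-1) 0
      - E 0 3 (-2) 1
      + q ^- 2 *: E 1 0 1 (-1)
      + q ^+ 2 *: E 1 2 0 (-1)
      + q ^+ 3 *: E 1 3 (-1) 0
      - q^-1 *: E 2 0 1 0
      + q ^- 2 *: E 2 1 0 1
      - q ^- 2 *: E 2 3 (-1) 1
      - q ^- 4 *: E 3 0 2 (-1)
      + q ^- 3 *: E 3 1 1 0
      - E 3 2 1 (-1))
  end.

Definition Fop (s : branch) (eta : 'Z_(2 * N)) : 'M[C]_2 :=
  match s with
  | Plus => diag2 1 (phase eta)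
  | Minus => diag2 (phase eta) 1
  end.

Definition onB (A : 'M[C]_2) : 'M[C]_(2 * 2 * dimE) := (1%:M *t A) *t 1%:M.

Definition seam (s : branch) (eta : 'Z_(2 * N)) : 'M[C]_(2 * 2 * dimE) :=
  onB (Fop s eta) *m Sop s *m onB (map_mx Num.conj (Fop s eta)^T).

Section Ring.

Variable L : nat.

(* The index set of the product basis of the ring Hilbert space: a spin
   configuration together with an endpoint basis index. *)
Definition config : finType := ({ffun 'Z_L -> 'I_2} * 'Z_N)%type.

Local Notation op := 'M[C]_(#|config|).

Definition op_of (K : config -> config -> C) : op :=
  \matrix_(a, b) K (enum_val a) (enum_val b).

Definition local_index (i j : 'Z_L) (x : config) : 'I_(2 * 2 * dimE) :=
  mxtens_index (mxtens_index (x.1 i, x.1 j), x.2).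

(* K acting on site i (as A), site j (as B) and the endpoint, and as the
   identity on every other site; meant for i != j. *)
Definition embed (i j : 'Z_L) (K : 'M[C]_(2 * 2 * dimE)) : op :=
  op_of (fun x y =>
    [forall l : 'Z_L, (l != i) && (l != j) ==> (x.1 l == y.1 l)]%:R
    * K (local_index i j x) (local_index i j y)).

Definition ringH (s : branch) (eta : 'Z_(2 * N)) (k : 'Z_L) : op :=
  \sum_(j : 'Z_L | j != k - 1) embed j (j + 1) (bond *t 1%:M)
  + embed (k - 1) k (seam s eta).

Definition chargeQ : op :=
  op_of (fun x y =>
    (\prod_(l : 'Z_L) diag2 1 omega (x.1 l) (y.1 l)) * clockZ^-1 x.2 y.2).

End Ring.

End Model.

Definition eigenstate (F : fieldType) (n : nat) (A : 'M[F]_n) (a : F)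
    (psi : 'cV[F]_n) : Prop :=
  psi != 0 /\ A *m psi = a *: psi.

Definition nu (N M : nat) (eta : 'Z_(2 * N)) : int :=
  (-1) ^ ((eta : nat)%:Z - (1 - M%:Z)).

Definition sector_const (s : branch) (L kappa : nat) : int :=
  match s with
  | Plus => 2 * L%:Z + 1 - kappa%:Z
  | Minus => - 1 - kappa%:Z
  end.

Definition partner (N : nat) (c : int) (m : 'Z_N) : 'Z_N := c%:~R - m.

(* Main.v *)
(* Let W act on wave functions by
     (W psi)(x, n) = (prod_l ramp l ^ x_l) * psi(x flipped at every site, s - n).
   The flip exchanges the bond phases q and q^-1, and a weight [ramp l]
   proportional to q^(2 l) undoes this on every ordinary bond.  Across the seam
   the ramp jumps; in every term of S_+ and S_-, flipping both spins and
   reflecting the endpoint negates the powers of X and of Z, so the shift s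
   contributes a factor omega^(+-s) which absorbs the jump together with the
   seam phase f_eta.  Solving for s gives s = L - c with c = c_eta^sigma.  Hence
   W commutes with H and carries the charge sector m to L - s - m = c - m.
   Finally eta is even because M is odd, so kappa is even and c is odd; as N is
   even, no sector is fixed. *)
Require Import Defs.
From mathcomp Require Import all_boot all_order all_algebra.
From mathcomp Require Import all_classical all_reals all_analysis.
From mathcomp Require Import complex mxtens.
From mathcomp Require Import zify ring.

Import Order.TTheory GRing.Theory Num.Theory.

Local Open Scope ring_scope.

Set Implicit Arguments.
Unset Strict Implicit.
Unset Printing Implicit Defensive.

(** Positive and negative powers are treated at once: to compute [x ^ z] it suffices to guess a
    closed form [T z], check its additivity, and compare at [z = 1]. No inverse has to be
    computed. *)
Lemma exprz_hom (A : unitRingType) (T : int -> A) :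
  T 0 = 1 -> (forall a b, T (a + b) = T a * T b) -> forall z, T z = T 1 ^ z.
Proof.
move=> T0 TD.
have Tnat (n : nat) : T n = T 1 ^ n.
  by elim: n => [|n IHn]; rewrite ?T0 ?expr0z// intS TD IHn -exprSz.
case=> [n|n]; first exact: Tnat.
have u : T n.+1 \is a GRing.unit.
  by apply/unitrP; exists (T (- n.+1%:Z)); rewrite -!TD addNr addrN T0.
by apply: (mulrI u); rewrite NegzE -TD subrr T0 -invr_expz -Tnat divrr.
Qed.

Lemma unit_circle_mul_conj (R : realType) (z : R[i]) (t : R) :
  z = (cos t +i* sin t)%C -> z * Num.conj z = 1.
Proof.
move=> ->.
have -> : Num.conj (cos t +i* sin t)%C = (cos t -i* sin t)%C by [].
apply/eqP; rewrite eq_complex /=.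
have := cos2Dsin2 t; rewrite !expr2 => h.
by rewrite mulrN opprK h mulrN (mulrC (sin t)) addNr !eqxx.
Qed.

(** * Roots of unity: [eps], [q] and [omega] *)

Section RootsOfUnity.

Variables (R : realType) (N M : nat).

Local Notation e := (eps R N).
Local Notation w := (omega R N M).

Lemma eps_expE k :
  e ^+ k = (cos (k%:R * (pi / N%:R)) +i* sin (k%:R * (pi / N%:R)))%C.
Proof.
elim: k => [|k IHk]; first by rewrite expr0 mul0r cos0 sin0.
rewrite exprS IHk /eps.
have -> : k.+1%:R * (pi / N%:R) = pi / N%:R + k%:R * (pi / N%:R) :> R.
  by rewrite -[k.+1%:R]natr1 mulrDl mul1r addrC.
rewrite cosD sinD; apply/eqP; rewrite eq_complex /= eqxx /=.
by rewrite addrC.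
Qed.

Lemma eps_neq0 : e != 0.
Proof.
apply/eqP => e0.
by have /eqP := unit_circle_mul_conj (erefl e); rewrite e0 mul0r eq_sym oner_eq0.
Qed.

Lemma conj_eps : Num.conj e = e^-1.
Proof.
by apply: (mulfI eps_neq0); rewrite (unit_circle_mul_conj (erefl e)) mulfV ?eps_neq0.
Qed.

Lemma q_neq0 : q R N M != 0.
Proof. by rewrite expf_neq0 ?eps_neq0. Qed.

Lemma omega_neq0 : w != 0.
Proof. by rewrite expf_neq0 ?q_neq0. Qed.

Hypothesis hN : (2 <= N)%N.

(** If the order [k] were below [N], [eps ^+ k] would square to 1 and so be real, while its
    imaginary part [sin (k pi / N)] is positive for [0 < k < N]. *)
Lemma eps_sqr_prim : N.-primitive_root (e ^+ 2).
Proof.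
have N0 : (0 < N%:R :> R) by rewrite ltr0n (leq_trans _ hN).
have eN : (e ^+ 2) ^+ N = 1.
  rewrite -exprM mulnC exprM eps_expE mulrC divfK ?gt_eqF//.
  rewrite cospi sinpi expr2; apply/eqP.
  by rewrite eq_complex /= !(mulr0, mul0r, subr0, addr0, mulrNN, mulr1, eqxx).
have [k kN kP] := prim_order_exists (leq_trans (isT : (0 < 2)%N) hN) eN.
have k0 := prim_order_gt0 kN.
have := dvdn_leq (leq_trans (isT : (0 < 2)%N) hN) kP.
rewrite leq_eqVlt => /orP[/eqP kE|kltN]; first by rewrite -[X in X.-primitive_root _]kE.
have t0 : 0 < sin (k%:R * (pi / N%:R)) :> R.
  apply: sin_gt0_pi; rewrite mulr_gt0 ?ltr0n ?divr_gt0 ?pi_gt0//=.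
  by rewrite mulrCA gtr_pMr ?pi_gt0// ltr_pdivrMr// mul1r ltr_nat.
have /eqP := prim_expr_order kN.
rewrite -exprM mulnC exprM sqrf_eq1 (eps_expE k) !eq_complex /= oppr0.
by rewrite (gt_eqF t0) !andbF.
Qed.

Hypothesis hMN : coprime M N.

Lemma omega_prim : N.-primitive_root w.
Proof.
by rewrite /omega /q exprAC prim_root_exp_coprime ?eps_sqr_prim.
Qed.

(* The exponent in [w ^+ a] is the least residue of [a]. *)
Lemma omega_exp_add (a b : 'Z_N) : w ^+ (a + b)%R = w ^+ a * w ^+ b.
Proof.
rewrite -exprD.
have hN' : (Zp_trunc N).+2 = N by rewrite Zp_cast.
rewrite /= [X in (_ %% X)%N]hN'.
by rewrite (expr_mod _ (prim_expr_order omega_prim)).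
Qed.

Lemma omega_exp_int (z : int) : w ^+ (z%:~R : 'Z_N) = w ^ z.
Proof.
have := @exprz_hom _ (fun z : int => w ^+ (z%:~R : 'Z_N)).
move=> ->; rewrite ?mulr1z.
- by rewrite /= /Zp_trunc modn_small ?expr1.
- by rewrite mulr0z expr0.
- by move=> a b; rewrite intrD omega_exp_add.
Qed.

Lemma omega_exp_nat (k : nat) : w ^+ (k%:R : 'Z_N) = w ^+ k.
Proof. exact: (omega_exp_int k). Qed.

Lemma omega_exp_inj (a b : 'Z_N) : w ^+ a = w ^+ b -> a = b.
Proof.
have lt (x : 'Z_N) : (x < N)%N by rewrite -[X in (_ < X)%N](Zp_cast hN) ltn_ord.
move=> /eqP; rewrite (eq_prim_root_expr omega_prim) !modn_small//.
by move/eqP/val_inj.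
Qed.

End RootsOfUnity.

(** * Operators given by kernels on configurations, and the mirror operator *)

Section KernelOperators.

Variables (R : realType) (N L : nat).

Local Notation C := R[i].
Local Notation cfg := (config N L).

Lemma mul_op_of_mx (K : cfg -> cfg -> C) (psi : 'cV[C]_#|cfg|) x :
  (op_of K *m psi) (enum_rank x) 0 = \sum_y K x y * psi (enum_rank y) 0.
Proof.
rewrite mxE (reindex_onto (@enum_rank cfg) enum_val) /=; last first.
  by move=> i _; rewrite enum_valK.
apply: eq_big => [y|y _]; first by rewrite enum_rankK eqxx.
by rewrite mxE !enum_rankK.
Qed.

Lemma mul_op_of (K K' : cfg -> cfg -> C) :
  op_of K *m op_of K' = op_of (fun x y => \sum_z K x z * K' z y).
Proof.
apply/matrixP => i j; rewrite -(enum_valK i) -(enum_valK j).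
rewrite !mxE (reindex_onto (@enum_rank cfg) enum_val) /=; last first.
  by move=> k _; rewrite enum_valK.
apply: eq_big => [y|y _]; first by rewrite enum_rankK eqxx.
by rewrite !mxE !enum_rankK.
Qed.

Lemma eq_op_of (K K' : cfg -> cfg -> C) :
  (forall x y, K x y = K' x y) -> op_of K = op_of K'.
Proof. by move=> eqK; apply/matrixP => i j; rewrite !mxE eqK. Qed.

Lemma colP_rank (psi phi : 'cV[C]_#|cfg|) :
  (forall x, psi (enum_rank x) 0 = phi (enum_rank x) 0) -> psi = phi.
Proof.
by move=> e; apply/colP => i; rewrite -(enum_valK i) e.
Qed.

Variables (gam : 'Z_L -> C) (s : 'Z_N).

(** On ['I_2], [rev_ord] is the spin flip. *)
Definition invert (x : cfg) : cfg := ([ffun l => rev_ord (x.1 l)], s - x.2).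

Definition weight (x : cfg) : C := \prod_l gam l ^+ x.1 l.

(** This is the operator W, with the ramp [gam] and the shift [s] left free so that each local term
    can state what it requires of them. *)
Definition mirror : 'M[C]_#|cfg| :=
  op_of (fun x y => weight x * (y == invert x)%:R).

Lemma invertK : involutive invert.
Proof.
case=> x n; congr pair; rewrite /= ?subKr//.
by apply/ffunP => l; rewrite !ffunE rev_ordK.
Qed.

Lemma mirrorE (psi : 'cV[C]_#|cfg|) x :
  (mirror *m psi) (enum_rank x) 0 = weight x * psi (enum_rank (invert x)) 0.
Proof.
rewrite mul_op_of_mx (bigD1 (invert x)) //= eqxx mulr1 big1 ?addr0//.
by move=> y /negbTE ->; rewrite mulr0 mul0r.
Qed.

(** [mirror] is a permutation matrix with rescaled rows, and the scale factors do not vanish. *)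
Lemma mirror_neq0 (psi : 'cV[C]_#|cfg|) :
  (forall l, gam l != 0) -> psi != 0 -> mirror *m psi != 0.
Proof.
move=> gam0; apply: contra_neq => m0; apply: colP_rank => x.
have := mirrorE psi (invert x); rewrite invertK m0 !mxE => /esym/eqP.
rewrite mulf_eq0 => /orP[|/eqP//].
by rewrite prodf_seq_eq0 => /hasP[l _ /=]; rewrite expf_eq0 (negbTE (gam0 l)) andbF.
Qed.

(** Each product with [mirror] has a single surviving summand; the hypothesis is the resulting
    equality of kernels with [invert y] in place of [y]. *)
Lemma op_of_mirror_comm (K : cfg -> cfg -> C) :
  (forall x y, K x y * weight y = weight x * K (invert x) (invert y)) ->
  op_of K *m mirror = mirror *m op_of K.
Proof.
move=> KE; rewrite !mul_op_of; apply: eq_op_of => x y.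
rewrite (bigD1 (invert y)) //= invertK eqxx mulr1 big1 ?addr0; last first.
  move=> z /negbTE zy; rewrite -[y]invertK (inj_eq (inv_inj invertK)) eq_sym.
  by rewrite zy !mulr0.
rewrite (bigD1 (invert x)) //= eqxx mulr1 big1 ?addr0; last first.
  by move=> z /negbTE ->; rewrite mulr0 mul0r.
by rewrite KE invertK.
Qed.

Lemma weight_split (i j : 'Z_L) (x : cfg) : i != j ->
  weight x = \prod_(l | (l != i) && (l != j)) gam l ^+ x.1 l *
             (gam i ^+ x.1 i * gam j ^+ x.1 j).
Proof.
move=> ij; rewrite /weight (bigD1 i) //= (bigD1 j) 1?eq_sym//=.
by rewrite mulrA mulrC.
Qed.

(** Off [i] and [j] the two configurations must agree, so the weights there cancel and a condition
    on the local kernel remains, involving only [gam i], [gam j] and [s]. *)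
Lemma embed_mirror_comm (i j : 'Z_L) (K : 'M[C]_(2 * 2 * (Zp_trunc N).+2)) :
  i != j ->
  (forall (a b a' b' : 'I_2) (n n' : 'Z_N),
    K (mxtens_index (mxtens_index (a, b), n))
      (mxtens_index (mxtens_index (a', b'), n')) * (gam i ^+ a' * gam j ^+ b') =
    gam i ^+ a * gam j ^+ b *
    K (mxtens_index (mxtens_index (rev_ord a, rev_ord b), s - n))
      (mxtens_index (mxtens_index (rev_ord a', rev_ord b'), s - n'))) ->
  embed i j K *m mirror = mirror *m embed i j K.
Proof.
move=> ij KE; apply: op_of_mirror_comm => x y.
have -> : [forall l, (l != i) && (l != j) ==>
             ((invert x).1 l == (invert y).1 l)] =
          [forall l, (l != i) && (l != j) ==> (x.1 l == y.1 l)].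
  by apply: eq_forallb => l; rewrite !ffunE (inj_eq rev_ord_inj).
case: forallP => [xy|_]; last by rewrite !mul0r mulr0.
rewrite !mul1r !(weight_split _ ij).
have -> : \prod_(l | (l != i) && (l != j)) gam l ^+ x.1 l =
          \prod_(l | (l != i) && (l != j)) gam l ^+ y.1 l.
  by apply: eq_bigr => l lij; have := xy l; rewrite lij /= => /eqP ->.
by rewrite /local_index mulrCA KE -!mulrA !ffunE.
Qed.

End KernelOperators.

(* Kept abstract: reassociating sums directly at a matrix type makes unification
   unfold the matrix operations. *)
Lemma sum12 (V : zmodType) (a b c d e f g h i j k l : V) :
  a + b + c + d + e + f + g + h + i + j + k + l =
  a + (b + (c + (d + (e + (f + (g + (h + (i + (j + (k + (l + 0))))))))))).
Proof. by rewrite addr0 !addrA. Qed.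

(** * Matrix entries of the seam and its behaviour under the mirror *)

Section LocalOperators.

Variables (R : realType) (N M : nat).

Hypothesis hN : (2 <= N)%N.
Hypothesis hMN : coprime M N.

Local Notation C := R[i].
Local Notation dimE := (Zp_trunc N).+2.
Local Notation q := (q R N M).
Local Notation w := (omega R N M).

Lemma shiftX_exp (z : int) (n n' : 'Z_N) :
  (shiftX R N ^ z) n n' = (n == n' + z%:~R)%:R.
Proof.
(* The guessed closed form of the [z]-th power, to be fed to [exprz_hom]. *)
pose T (z : int) : 'M[C]_dimE := \matrix_(n, n') (n == n' + z%:~R :> 'Z_N)%:R.
have <- : T 1 = shiftX R N by apply/matrixP => i j; rewrite !mxE.
rewrite -(@exprz_hom _ T) ?mxE //.
  by apply/matrixP => i j; rewrite !mxE mulr0z addr0.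
move=> a b; apply/matrixP => i j.
rewrite !mxE (bigD1 (j + b%:~R)) //= !mxE eqxx mulr1 big1 ?addr0.
  by rewrite intrD [a%:~R + _]addrC addrA.
by move=> k /negbTE kj; rewrite !mxE kj mulr0.
Qed.

Lemma clockZ_exp (z : int) (n n' : 'Z_N) :
  (clockZ R N M ^ z) n n' = (n == n')%:R * (w ^+ n') ^ z.
Proof.
pose T (z : int) : 'M[C]_dimE := diag_mx (\row_n (w ^+ n) ^ z).
have <- : T 1 = clockZ R N M.
  by apply/matrixP => i j; rewrite !mxE expr1z.
rewrite -(@exprz_hom _ T).
- by rewrite !mxE; case: eqP => [->|_]; rewrite ?mul1r ?mul0r.
- by apply/matrixP => i j; rewrite !mxE expr0z.
move=> a b; rewrite -[RHS]/(T a *m T b) /T mulmx_diag.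
congr diag_mx; apply/rowP => i.
by rewrite !mxE expfzDr// expf_neq0// omega_neq0.
Qed.

Lemma Yop_entry (m z : int) (n n' : 'Z_N) :
  Yop R N M m z n n' = (n == n' + m%:~R)%:R * (w ^+ n') ^ z.
Proof.
rewrite /Yop mxE (bigD1 n') //= shiftX_exp clockZ_exp eqxx mul1r big1 ?addr0 //.
by move=> k kn; rewrite [X in _ * X]clockZ_exp (negbTE kn) mul0r mulr0.
Qed.

Lemma EY_entry (r c : nat) (m z : int) (a b a' b' : 'I_2) (n n' : 'Z_N) :
  (r < 4)%N -> (c < 4)%N ->
  EY R N M r c m z (mxtens_index (mxtens_index (a, b), n))
    (mxtens_index (mxtens_index (a', b'), n')) =
  ((a * 2 + b == r) && (a' * 2 + b' == c))%N%:R *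
  ((n == n' + m%:~R)%:R * (w ^+ n') ^ z).
Proof.
move=> r4 c4; rewrite /EY tensmxE Yop_entry; congr (_ * _).
by rewrite [LHS]mxE -!val_eqE /= !inordK.
Qed.

Lemma onB_diag2 (f0 f1 : C) :
  onB N (diag2 f0 f1) =
  diag_mx (\row_u if (mxtens_unindex (mxtens_unindex u).1).2 == 0 then f0 else f1).
Proof.
apply/matrixP => u v.
case: (mxtens_indexP u) => {}u n; case: (mxtens_indexP u) => a b.
case: (mxtens_indexP v) => {}v n'; case: (mxtens_indexP v) => a' b'.
rewrite /onB !tensmxE !mxE !mxtens_indexK /=.
rewrite !(inj_eq (can_inj (@mxtens_indexK _ _))) !xpair_eqE.
rewrite !(inj_eq (can_inj (@mxtens_indexK _ _))) !xpair_eqE.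
by do ?[case: eqP => _]; rewrite /= ?mulr0n ?mulr1n ?mul1r ?mulr1 ?mul0r ?mulr0.
Qed.

(** The terms as data: coefficient, matrix position, powers of X and Z. Every off-diagonal position
    of the 4 by 4 spin block occurs exactly once and no diagonal one does, so selecting by position
    leaves at most one term. *)
Definition Sop_terms (br : branch) : seq (C * (nat * nat) * (int * int)) :=
  match br with
  | Plus =>
    [:: (- 1, (0, 1)%N, (-1, -1));
        (q ^+ 3, (0, 2)%N, (-1, 0));
        (- q ^+ 4, (0, 3)%N, (-2, -1));
        (- q ^+ 2, (1, 0)%N, (1, 1));
        (q ^+ 2, (1, 2)%N, (0, 1));
        (- q, (1, 3)%N, (-1, 0));
        (q ^- 3, (2, 0)%N, (1, 0));
        (q ^- 2, (2, 1)%N, (0, -1));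
        (q ^+ 2, (2, 3)%N, (-1, -1));
        (- 1, (3, 0)%N, (2, 1));
        (- q^-1, (3, 1)%N, (1, 0));
        (1, (3, 2)%N, (1, 1))]
  | Minus =>
    [:: (1, (0, 1)%N, (-1, 1));
        (- q, (0, 2)%N, (-1, 0));
        (- 1, (0, 3)%N, (-2, 1));
        (q ^- 2, (1, 0)%N, (1, -1));
        (q ^+ 2, (1, 2)%N, (0, -1));
        (q ^+ 3, (1, 3)%N, (-1, 0));
        (- q^-1, (2, 0)%N, (1, 0));
        (q ^- 2, (2, 1)%N, (0, 1));
        (- q ^- 2, (2, 3)%N, (-1, 1));
        (- q ^- 4, (3, 0)%N, (2, -1));
        (q ^- 3, (3, 1)%N, (1, 0));
        (- 1, (3, 2)%N, (1, -1))]
  end.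

Lemma Sop_sum (br : branch) :
  Sop R N M br = 2%:R^-1 *:
    \sum_(t <- Sop_terms br) t.1.1 *: EY R N M t.1.2.1 t.1.2.2 t.2.1 t.2.2.
Proof.
rewrite /Sop /Sop_terms; move: (@EY R N M) q => E x.
case: br; congr (_ *: _); rewrite !big_cons big_nil [RHS]/= !scaleNr !scale1r.
all: exact: sum12.
Qed.

Lemma Sop_entry (br : branch) (a b a' b' : 'I_2) (n n' : 'Z_N) :
  Sop R N M br (mxtens_index (mxtens_index (a, b), n))
    (mxtens_index (mxtens_index (a', b'), n')) =
  2%:R^-1 * \sum_(t <- [seq t <- Sop_terms br |
                         (a * 2 + b, a' * 2 + b')%N == t.1.2])
    t.1.1 * ((n == n' + t.2.1%:~R)%:R * (w ^+ n') ^ t.2.2).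
Proof.
rewrite Sop_sum mxE summxE big_filter; congr (_ * _).
(* Indices below 4 are what makes [inord] in [EY] faithful. *)
have lt4 : all (fun t => (t.1.2.1 < 4) && (t.1.2.2 < 4))%N (Sop_terms br).
  by case: br.
rewrite [RHS]big_mkcond !big_seq; apply: eq_bigr => t /(allP lt4)/andP[r4 c4].
rewrite mxE EY_entry// -xpair_eqE -surjective_pairing.
by case: ifP; rewrite ?mul1r// mul0r mulr0.
Qed.

Lemma phase_neq0 (eta : 'Z_(2 * N)) : phase R eta != 0.
Proof. by rewrite expf_neq0 ?eps_neq0. Qed.

Lemma conj_phase (eta : 'Z_(2 * N)) : Num.conj (phase R eta) = (phase R eta)^-1.
Proof. by rewrite /phase rmorphXn /= conj_eps exprVn. Qed.

Lemma conj_diag2 (f0 f1 : C) :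
  map_mx Num.conj (diag2 f0 f1)^T = diag2 (Num.conj f0) (Num.conj f1).
Proof.
rewrite /diag2 tr_diag_mx map_diag_mx; congr diag_mx.
by apply/rowP => i; rewrite !mxE; case: ifP.
Qed.

Lemma seam_diag2 (f0 f1 : C) (A : 'M[C]_(2 * 2 * dimE)) (a b a' b' : 'I_2)
    (n n' : 'Z_N) :
  (onB N (diag2 f0 f1) *m A *m onB N (map_mx Num.conj (diag2 f0 f1)^T))
    (mxtens_index (mxtens_index (a, b), n))
    (mxtens_index (mxtens_index (a', b'), n')) =
  (if b == 0 then f0 else f1) *
  A (mxtens_index (mxtens_index (a, b), n))
    (mxtens_index (mxtens_index (a', b'), n')) *
  (if b' == 0 then Num.conj f0 else Num.conj f1).
Proof.
by rewrite conj_diag2 !onB_diag2 mul_mx_diag mxE mul_diag_mx !mxE !mxtens_indexK.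
Qed.

Lemma omega_exp_sub (a b : 'Z_N) : w ^+ (a - b)%R = w ^+ a / w ^+ b.
Proof.
have b0 : w ^+ b != 0 by rewrite expf_neq0// omega_neq0.
by apply: (mulIf b0); rewrite divfK// -omega_exp_add// subrK.
Qed.

(** Reflecting the endpoint turns the power [m] of X into [- m]. *)
Lemma eq_sub_shift (s n n' : 'Z_N) (m : int) :
  (s - n == s - n' + m%:~R) = (n == n' + (- m)%:~R).
Proof. by rewrite intrN -subr_eq0 -[RHS]subr_eq0 -oppr_eq0; congr (_ == 0); ring. Qed.

(** The value required of [omega ^+ s] for the seam terms to match; [p] stands for [q ^+ L] and [f]
    for the seam phase. *)
Definition mirror_shift (br : branch) (p f : C) : C :=
  match br with
  | Plus => (q ^+ 2 * p ^+ 2 * f ^+ 2)^-1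
  | Minus => q ^+ 2 * p ^+ 2 / f ^+ 2
  end.

(** Flipping both spins sends position [(r, c)] to [(3 - r, 3 - c)], which pairs the twelve terms.
    Here [ga] and [gb] are the ramp values at the sites [L - 1] and [0] on either side of the
    seam. *)
Lemma seam_mirror (br : branch) (eta : 'Z_(2 * N)) (p ga gb : C) (s : 'Z_N) :
  p != 0 -> ga = - q ^- 4 -> gb = - (q ^+ 2 * p ^+ 2)^-1 ->
  w ^+ s = mirror_shift br p (phase R eta) ->
  forall (a b a' b' : 'I_2) (n n' : 'Z_N),
    seam R M br eta (mxtens_index (mxtens_index (a, b), n))
      (mxtens_index (mxtens_index (a', b'), n')) * (ga ^+ a' * gb ^+ b') =
    ga ^+ a * gb ^+ b *
    seam R M br eta (mxtens_index (mxtens_index (rev_ord a, rev_ord b), s - n))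
      (mxtens_index (mxtens_index (rev_ord a', rev_ord b'), s - n')).
Proof.
move=> p0 gaE gbE ws a b a' b' n n'.
have q0 := q_neq0 R N M.
have f0 := phase_neq0 eta.
have t0 : w ^+ n' != 0 by rewrite expf_neq0// omega_neq0.
(* The powers of Z are evaluated at the reflected endpoint [s - n']; this is where the value of
   [w ^+ s] enters. *)
have wsn := omega_exp_sub s n'; rewrite ws in wsn.
rewrite gaE gbE /seam; case: br ws wsn => ws wsn;
  rewrite /Fop !seam_diag2 !Sop_entry !wsn rmorph1 conj_phase /mirror_shift /Sop_terms;
  move: (phase R eta) (w ^+ n') q f0 t0 q0 {ws wsn gaE gbE} => f t x f0 t0 x0;
  case: a => [[|[|//]] ia]; case: b => [[|[|//]] ib];
  case: a' => [[|[|//]] ia']; case: b' => [[|[|//]] ib'];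
  rewrite [LHS]/= [RHS]/= ?big_nil ?big_seq1 ?eq_sub_shift ?(mulr0, mul0r) //;
  rewrite [LHS]/= [RHS]/= ?opprK ?oppr0 ?exprN1 ?expr1z ?expr0z;
  (* Both sides carry the same endpoint delta [d]; what is left is an identity of rational
     functions. *)
  move: (_ == _)%:R => d; field.
all: by rewrite ?x0 ?p0 ?f0 ?t0.
Qed.

End LocalOperators.

(** * The ordinary bond under the mirror *)

Section BondOperator.

Variables (R : realType) (N M : nat).

Local Notation C := R[i].
Local Notation dimE := (Zp_trunc N).+2.
Local Notation q := (q R N M).

Lemma bond_entry (a b a' b' : 'I_2) :
  bond R N M (mxtens_index (a, b)) (mxtens_index (a', b')) =
  q * (sigmap R a a' * sigmam R b b') + q^-1 * (sigmam R a a' * sigmap R b b') +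
  (q + q^-1) / 4%:R * (sigmaz R a a' * sigmaz R b b').
Proof.
rewrite -!tensmxE /bond.
by move: (sigmap R *t _) (sigmam R *t _) (sigmaz R *t _) => A B D; rewrite !mxE.
Qed.

Lemma bond_mirror (ga gb : C) (s : 'Z_N) : gb = q ^+ 2 * ga ->
  forall (a b a' b' : 'I_2) (n n' : 'Z_N),
    (bond R N M *t 1%:M) (mxtens_index (mxtens_index (a, b), n))
      (mxtens_index (mxtens_index (a', b'), n')) * (ga ^+ a' * gb ^+ b') =
    ga ^+ a * gb ^+ b *
    (bond R N M *t 1%:M) (mxtens_index (mxtens_index (rev_ord a, rev_ord b), s - n))
      (mxtens_index (mxtens_index (rev_ord a', rev_ord b'), s - n')).
Proof.
move=> -> a b a' b' n n'.
have q0 := q_neq0 R N M; move: q0; rewrite !tensmxE !bond_entry.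
have -> : (1%:M : 'M[C]_dimE) (s - n) (s - n') = (1%:M : 'M[C]_dimE) n n'.
  by rewrite !mxE (inj_eq (inv_inj (subKr s))).
move: q ((1%:M : 'M[C]_dimE) n n') => x d x0.
rewrite /sigmap /sigmam /sigmaz /diag2 !mxE.
case: a => [[|[|//]] ia]; case: b => [[|[|//]] ib];
case: a' => [[|[|//]] ia']; case: b' => [[|[|//]] ib'];
rewrite [LHS]/= [RHS]/= ?mulr1n ?mulr0n; by field.
Qed.

End BondOperator.

(** * Eigenvectors and charge sectors *)

Lemma eigenstate_free (F : fieldType) (n : nat) (A : 'M[F]_n) (a b : F)
    (u v : 'cV[F]_n) :
  a != b -> eigenstate A a u -> eigenstate A b v -> free [:: u; v].
Proof.
move=> ab [u0 Au] [v0 Av]; rewrite free_cons seq1_free v0 andbT span_seq1.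
apply/negP => /vlineP[k uk]; case/eqP: u0; apply/eqP.
have : (a - b) *: u == 0.
  by rewrite scalerBl -Au uk -scalemxAr Av !scalerA mulrC subrr.
by rewrite scaler_eq0 subr_eq0 (negbTE ab).
Qed.

Section Charge.

Variables (R : realType) (N M L : nat).

Hypothesis hN : (2 <= N)%N.
Hypothesis hMN : coprime M N.
Hypothesis hL : (2 <= L)%N.

Local Notation C := R[i].
Local Notation cfg := (config N L).
Local Notation w := (omega R N M).

Definition charge (x : cfg) : 'Z_N := (\sum_l (x.1 l : nat))%:R - x.2.

Lemma chargeQE :
  chargeQ R N M L = op_of (fun x y => (x == y)%:R * w ^+ charge x).
Proof.
apply: eq_op_of => -[x n] [y k] /=.
rewrite -exprN1 clockZ_exp // exprN1 /charge omega_exp_sub//=.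
have -> : w ^+ ((\sum_l (x l : nat))%:R : 'Z_N) = \prod_l w ^+ x l.
  by rewrite omega_exp_nat// expr_sum.
rewrite xpair_eqE; have [<-|xy] := eqVneq x y.
  rewrite /=; have [<-|nk] := eqVneq n k; last by rewrite !mul0r mulr0.
  rewrite !mul1r; congr (_ * _); apply: eq_bigr => l _.
  by rewrite !mxE eqxx mulr1n; case: (x l) => [[|[|//]] ?].
rewrite /= mul0r.
have [l xyl] : exists l, x l != y l.
  by apply/existsP; rewrite -negb_forall; apply: contra xy => /forallP e;
    apply/eqP/ffunP => l; apply/eqP.
by rewrite (bigD1 l) //= !mxE (negbTE xyl) mulr0n !mul0r.
Qed.

Lemma chargeQ_entry (psi : 'cV[C]_#|cfg|) x :
  (chargeQ R N M L *m psi) (enum_rank x) 0 = w ^+ charge x * psi (enum_rank x) 0.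
Proof.
rewrite chargeQE mul_op_of_mx (bigD1 x) // eqxx mul1r big1; first exact: addr0.
by move=> y; rewrite andTb eq_sym => /negbTE ->; rewrite !mul0r.
Qed.

(** With [k] spins in state 1 and endpoint [n], the image has [L - k] such spins and endpoint
    [s - n]. *)
Lemma charge_invert (s : 'Z_N) x : charge (invert s x) = L%:R - s - charge x.
Proof.
rewrite /charge /=.
have -> : (\sum_l ([ffun l => rev_ord (x.1 l)] l : nat))%:R =
          L%:R - (\sum_l (x.1 l : nat))%:R :> 'Z_N.
  apply/eqP; rewrite eq_sym subr_eq -natrD -big_split /=; apply/eqP; congr (_%:R).
  transitivity (\sum_(l : 'Z_L) 1)%N; first by rewrite sum1_card card_ord Zp_cast.
  by apply: eq_bigr => l _; rewrite ffunE /=; case: (x.1 l) => [[|[|//]] ?].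
ring.
Qed.

(** Since Q is diagonal, an eigenvector is supported on configurations whose charge gives its
    eigenvalue. *)
Lemma sector_support (lam : C) (psi : 'cV[C]_#|cfg|) :
  chargeQ R N M L *m psi = lam *: psi ->
  forall x, psi (enum_rank x) 0 != 0 -> lam = w ^+ charge x.
Proof.
move=> Qpsi x psix; apply: (mulIf psix).
by rewrite -chargeQ_entry Qpsi mxE.
Qed.

Lemma sector_exists (lam : C) (psi : 'cV[C]_#|cfg|) :
  eigenstate (chargeQ R N M L) lam psi -> exists m : 'Z_N, lam = w ^+ m.
Proof.
move=> [psi0 Qpsi].
have [x psix] : exists x, psi (enum_rank x) 0 != 0.
  apply/existsP; rewrite -negb_forall; apply: contra psi0 => /forallP e.
  by apply/eqP/colP_rank => x; rewrite mxE; apply/eqP.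
by exists (charge x); apply: sector_support psix.
Qed.

Lemma mirror_sector gam (s m : 'Z_N) (psi : 'cV[C]_#|cfg|) :
  chargeQ R N M L *m psi = w ^+ m *: psi ->
  chargeQ R N M L *m (mirror gam s *m psi) =
    w ^+ (L%:R - s - m)%R *: (mirror gam s *m psi).
Proof.
move=> Qpsi; apply: colP_rank => x.
rewrite chargeQ_entry [RHS]mxE mirrorE.
have [->|psix] := eqVneq (psi (enum_rank (invert s x)) 0) 0; first by rewrite !mulr0.
(* Where [psi] does not vanish, the reflected configuration has charge [m], so [x] itself has charge
   [L - s - m]. *)
have /(omega_exp_inj hN hMN) -> := sector_support Qpsi psix.
by rewrite charge_invert subKr.
Qed.

End Charge.

(** * The mirror commutes with the ring Hamiltonian *)

Section RingSymmetry.

Variables (R : realType) (N M L : nat).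

Hypothesis hN : (2 <= N)%N.
Hypothesis hMN : coprime M N.
Hypothesis hL : (2 <= L)%N.

Local Notation C := R[i].
Local Notation q := (q R N M).
Local Notation w := (omega R N M).

(* Ordinary bonds only fix the ratio q^2 of consecutive values; the constant
   factor is forced by the seam terms that move the endpoint. *)
Definition ramp (l : 'Z_L) : C := - (q ^+ (2 * l) / (q ^+ 2 * (q ^+ L) ^+ 2)).

Lemma ramp_neq0 l : ramp l != 0.
Proof.
by rewrite oppr_eq0 !(mulf_eq0, invr_eq0, expf_eq0) (negbTE (eps_neq0 R N)) !andbF.
Qed.

Lemma val_ordN1 : (0 - 1 : 'Z_L) = L.-1 :> nat.
Proof.
have L2 : (Zp_trunc L).+2 = L by rewrite Zp_cast.
rewrite sub0r; have -> : (-1 : 'Z_L) = (L.-1)%:R.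
  by apply/eqP; rewrite eq_sym -subr_eq0 opprK -mulrSr prednK ?pchar_Zp// ltnW.
by rewrite val_Zp_nat// modn_small// prednK// ltnW.
Qed.

(** Away from the seam the successor does not wrap around, so [ramp (j + 1)] really is [q ^+ 2]
    times [ramp j]. *)
Lemma val_ordD1 (j : 'Z_L) : j != 0 - 1 -> (j + 1 : 'Z_L) = j.+1 :> nat.
Proof.
move=> jN1.
have L2 : (Zp_trunc L).+2 = L by rewrite Zp_cast.
have jL : (j < L)%N by rewrite -[X in (_ < X)%N]L2 ltn_ord.
have jS : (j.+1 < L)%N.
  rewrite ltn_neqAle jL andbT; apply: contra jN1 => /eqP jS.
  by apply/eqP/val_inj; rewrite [RHS]val_ordN1 -(congr1 predn jS).
rewrite -[j in LHS]natr_Zp -[1]/(1%:R) -natrD addn1 val_Zp_nat//.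
by rewrite modn_small.
Qed.

(** The shift [L - c] equals [kappa - (L + 1)] on the plus branch and [kappa + (L + 1)] on the minus
    branch, so the powers [omega ^+ kappa] and [omega ^+ L.+1] suffice. *)
Lemma omega_sector_shift (br : branch) (eta : 'Z_(2 * N)) (kappa : nat) :
  (M%:Z * kappa%:Z = - (eta : nat)%:Z %[mod N%:Z])%Z ->
  w ^+ (L%:R - (sector_const br L kappa)%:~R : 'Z_N)%R =
  mirror_shift N M br (q ^+ L) (phase R eta).
Proof.
move=> hk.
have wN0 := omega_neq0 R N M.
have e0 := eps_neq0 R N.
have q0 := q_neq0 R N M.
have f0 := phase_neq0 R eta.
(* Since [omega] is [eps ^+ (2 * M)], the congruence gets doubled, and a congruence modulo [N] is
   enough although [eps] is a root of unity of order [2 N]. *)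
have wk : w ^+ kappa = phase R eta ^- 2.
  have /eqP := hk; rewrite eqz_mod_dvd opprK => /dvdzP[k kE].
  have eN : eps R N ^ (2 * N%:Z)%R = 1.
    by rewrite -[2]/(2%:Z) -PoszM -exprnP exprM (prim_expr_order (eps_sqr_prim R hN)).
  apply: (mulIf (expf_neq0 2 f0)); rewrite mulVf ?expf_neq0//.
  rewrite /omega /phase /Defs.q -!exprM -exprD.
  have -> : eps R N ^+ (M * (2 * kappa) + eta * 2) = eps R N ^ (2 * N%:Z * k)%R.
    rewrite exprnP; congr (_ ^ _); move: kE; lia.
  by rewrite -exprz_exp eN exp1rz.
have wL : w ^+ L.+1 = q ^+ 2 * (q ^+ L) ^+ 2.
  by rewrite exprS /omega exprAC.
rewrite -[L%:R]/((L%:Z)%:~R) -intrB omega_exp_int//.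
case: br; rewrite /sector_const /mirror_shift.
  have -> : L%:Z - (2 * L%:Z + 1 - kappa%:Z) = kappa%:Z + - (L.+1)%:Z by lia.
  by rewrite expfzDr// -exprnP -exprnN wk wL mulrC -invfM.
have -> : L%:Z - (- 1 - kappa%:Z) = (L.+1)%:Z + kappa%:Z by lia.
by rewrite expfzDr// -!exprnP wk wL.
Qed.

Lemma ringH_mirror (br : branch) (eta : 'Z_(2 * N)) (s : 'Z_N) :
  w ^+ s = mirror_shift N M br (q ^+ L) (phase R eta) ->
  ringH R M br eta (0 : 'Z_L) *m mirror ramp s =
  mirror ramp s *m ringH R M br eta (0 : 'Z_L).
Proof.
move=> ws; have q0 := q_neq0 R N M.
rewrite /ringH mulmxDl mulmxDr mulmx_suml mulmx_sumr; congr (_ + _).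
  apply: eq_bigr => j jN1; apply: embed_mirror_comm.
    by rewrite -subr_eq0 opprD addNKr oppr_eq0 oner_neq0.
  apply: bond_mirror; rewrite /ramp val_ordD1// mulnS exprD.
  by rewrite mulrN [X in _ = - X]mulrA.
apply: embed_mirror_comm; first by rewrite subr_eq add0r eq_sym oner_neq0.
apply: seam_mirror ws => //; first by rewrite expf_neq0.
  (* At site [L - 1] the powers of [q] combine to [2 (L - 1) - 2 - 2 L = - 4]. *)
  rewrite /ramp val_ordN1; congr (- _).
  apply: (mulfI (expf_neq0 4 q0)); rewrite mulfV ?expf_neq0 ?eps_neq0//.
  rewrite mulrA -exprM -!exprD.
  have -> : (4 + 2 * L.-1 = 2 + L * 2)%N by lia.
  by rewrite mulfV ?expf_neq0 ?eps_neq0.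
by rewrite /ramp muln0 mul1r.
Qed.

End RingSymmetry.

(** * Parity, and the absence of fixed sectors *)

Lemma nu_eq1_even (N M : nat) (eta : 'Z_(2 * N)) :
  (0 < M)%N -> odd M -> nu M eta = 1 -> ~~ odd eta.
Proof.
move=> M0 oddM; rewrite /nu.
have -> : (eta : nat)%:Z - (1 - M%:Z) = (eta + M.-1)%N by lia.
rewrite -exprnP -signr_odd => h.
have : ~~ odd (eta + M.-1) by move: h; case: (odd _).
by rewrite oddD -subn1 oddB// oddM addbF.
Qed.

(** Modulo 2 the relation [M kappa + eta = k N] says that [kappa] is even; both constants are odd
    numbers minus [kappa]. *)
Lemma sector_const_odd (s : branch) (N M L kappa eta : nat) :
  ~~ odd N -> odd M -> ~~ odd eta ->
  (M%:Z * kappa%:Z = - eta%:Z %[mod N%:Z])%Z ->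
  exists d : int, sector_const s L kappa = 2 * d + 1.
Proof.
move=> evN odM evE /eqP; rewrite eqz_mod_dvd opprK => /dvdzP[k kE].
have evK : ~~ odd kappa.
  have : odd (M * kappa + eta) = odd (`|k| * N).
    by congr odd; move: kE; lia.
  by rewrite oddD !oddM odM (negbTE evN) (negbTE evE) andbF addbF /= => ->.
have [j jE] : exists j, kappa = (2 * j)%N.
  by exists kappa./2; move: (odd_double_half kappa); rewrite (negbTE evK); lia.
case: s; rewrite /sector_const jE.
  by exists (L%:Z - j%:Z); lia.
by exists (- 1 - j%:Z); lia.
Qed.

(** A fixed sector would make 2 invertible in ['Z_N], with inverse [m - d]. Multiplying by [N / 2]
    then gives [N / 2 = 0] in ['Z_N], which is absurd. *)
Lemma partner_neq (N : nat) (d : int) (m : 'Z_N) :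
  (2 <= N)%N -> ~~ odd N -> partner (2 * d + 1) m != m.
Proof.
move=> hN evN; rewrite /partner subr_eq; apply/eqP => h.
have N2 : (N./2 * 2 = N)%N by rewrite muln2 -[RHS]odd_double_half (negbTE evN).
have z0 : (N./2)%:R = 0 :> 'Z_N.
  have -> : (N./2)%:R = (m - d%:~R) * N%:R :> 'Z_N.
    have one : 1 = (m - d%:~R) * 2%:R :> 'Z_N.
      rewrite mulrBl mulr_natr mulr2n -h intrD intrM [d%:~R * _]mulrC.
      by rewrite addrAC subrr add0r.
    have NE : N%:R = (N./2)%:R * 2%:R :> 'Z_N by rewrite -natrM N2.
    by rewrite NE mulrCA -one mulr1.
  by rewrite pchar_Zp// mulr0.
have /eqP := congr1 (@nat_of_ord _) z0.
by rewrite val_Zp_nat// modn_small /=; lia.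
Qed.

(** * Construction of the partner eigenstate *)

Unset Implicit Arguments.

Theorem corollary5p3 (R : realType) (N M L : nat)
    (hN : (2 <= N)%N) (hNeven : ~~ odd N)
    (hM : (1 <= M < N)%N) (hMN : coprime M N) (hL : (3 <= L)%N)
    (eta : 'Z_(2 * N)) (hnu : nu M eta = 1)
    (kappa : 'I_N)
    (hkappa : (M%:Z * (kappa : nat)%:Z = - (eta : nat)%:Z %[mod N%:Z])%Z) :
  (forall s : branch, (sector_const s L kappa = 1 %[mod 2])%Z) /\
  (forall s : branch,
     let pm := @partner N (sector_const s L kappa) in
     involutive pm /\ (forall m : 'Z_N, pm m != m)) /\
  (forall (s : branch) (psi : 'cV[R[i]]_(#|config N L|)) (E lam : R[i]),
     let H := ringH R M s eta (0 : 'Z_L) in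
     let Q := chargeQ R N M L in
     let w := omega R N M in
     let pm := @partner N (sector_const s L kappa) in
     eigenstate H E psi -> eigenstate Q lam psi ->
     (exists m : 'Z_N, lam = w ^+ m) /\
     (forall m : 'Z_N, lam = w ^+ m ->
        exists phi : 'cV[R[i]]_(#|config N L|),
          [/\ eigenstate H E phi,
              eigenstate Q (w ^+ (pm m)) phi,
              w ^+ (pm m) != w ^+ m
            & free [:: psi; phi]])).
Proof.
have hL2 : (2 <= L)%N by exact: ltnW.
have oddM : odd M.
  (* An even [M] would share the factor 2 with [N]. *)
  apply: contraT => evM; move: hMN; rewrite /coprime => /eqP g1.
  have : (2 %| gcdn M N)%N by rewrite dvdn_gcd !dvdn2 evM.
  by rewrite g1.
have M0 : (0 < M)%N by case/andP: hM.
have evE := nu_eq1_even M0 oddM hnu.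
have cE s := sector_const_odd s L hNeven oddM evE hkappa.
have pm_neq s m : partner (sector_const s L kappa) m != m :> 'Z_N.
  by have [d ->] := cE s; apply: partner_neq.
split=> [s|]; first by have [d ->] := cE s; rewrite mulrC modzMDl.
split=> [s pm|s psi E lam H Q w pm [psi0 Hpsi] Qpsi].
  by split=> [m|m]; [rewrite /pm /partner subKr|exact: pm_neq].
split=> [|m lamE]; first exact: sector_exists Qpsi.
have wpm : w ^+ (pm m) != w ^+ m.
  by apply: contra (pm_neq s m) => /eqP/(omega_exp_inj hN hMN)/eqP.
(* Chosen so that the reflected charge [L - sh - m] is [c - m]. *)
pose sh : 'Z_N := L%:R - (sector_const s L kappa)%:~R.
have shE : L%:R - sh - m = pm m by rewrite subKr.
pose W := mirror (@ramp R N M L) sh.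
have W0 : W *m psi != 0 by apply: mirror_neq0 psi0 => l; apply: ramp_neq0.
have QW : eigenstate Q (w ^+ pm m) (W *m psi).
  split=> //; rewrite -shE; apply: mirror_sector => //.
  by rewrite -lamE; case: Qpsi.
exists (W *m psi); split=> //.
  split=> //; rewrite mulmxA ringH_mirror//; last exact: omega_sector_shift.
  by rewrite -mulmxA Hpsi scalemxAr.
(* The energies coincide, so independence comes from the distinct eigenvalues of Q. *)
by apply: eigenstate_free Qpsi QW; rewrite lamE eq_sym.
Qed.
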